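(* Let $k\ge1$, let $\varepsilon_1,\dots,\varepsilon_k>0$, and let $\mathcal{M}_i$ be the class of $\varepsilon_i$-bounded-range mechanisms, $i=1,\dots,k$. For $\varepsilon>0$ and $t\in[0,\varepsilon]$ put $p_{\varepsilon,t}=\frac{e^{-t}-e^{-\varepsilon}}{1-e^{-\varepsilon}}$, and for $\lambda>0$ put $$h_\varepsilon(\lambda)=\sup_{t\in[0,\varepsilon]}\Big\{\lambda(\varepsilon-t)+\ln\big(1+p_{\varepsilon,t}(e^{-\lambda\varepsilon}-1)\big)\Big\}.$$ Then for every $\varepsilon_g\ge0$, $(\mathcal{M}_1,\dots,\mathcal{M}_k)$ is $(\varepsilon_g,\delta_g(\varepsilon_g))$-DP under $k$-fold adaptive composition, where $$\delta_g(\varepsilon_g)=\inf_{\lambda>0}\exp\Big(-\lambda\varepsilon_g+\sum_{i=1}^k h_{\varepsilon_i}(\lambda)\Big).$$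
   Context: A data universe is a set $\mathcal{X}$ with a symmetric neighboring relation $x\sim x'$. A mechanism $M:\mathcal{X}\to\mathcal{Y}$ assigns to each $x$ a probability distribution of a random outcome $M(x)\in\mathcal{Y}$; $\Pr[M(x)=y]$ denotes the probability mass function, or, for continuous outcome spaces, the probability density function with respect to a common reference measure. $M$ is $\varepsilon$-bounded-range if for all neighbors $x\sim x'$ and all $y_1,y_2\in\mathcal{Y}$, $\frac{\Pr[M(x)=y_1]}{\Pr[M(x')=y_1]}\le e^{\varepsilon}\frac{\Pr[M(x)=y_2]}{\Pr[M(x')=y_2]}$ (in cross-multiplied form when probabilities vanish). Adaptive composition game: an adversary is a pair $\mathcal{A}=(\mathcal{R},\mathcal{D})$ with $\mathcal{R}$ a randomized algorithm and $\mathcal{D}$ a deterministic one. Given classes of mechanisms $\vec{\mathcal{E}}=(\mathcal{E}_1,\dots,\mathcal{E}_k)$ and a bit $b\in\{0,1\}$, the game $\mathrm{AdaComp}(\mathcal{A},\vec{\mathcal{E}},b)$ runs: draw $r_0\sim\mathcal{R}(\emptyset)$; for $i=1,\dots,k$: $\mathcal{D}(r_0,A_1^b,r_1,\dots,A_{i-1}^b,r_{i-1})$ selects neighboring datasets $x^{i,0}\sim x^{i,1}$ and a mechanism $M_i\in\mathcal{E}_i$, the outcome $A_i^b=M_i(x^{i,b})$ is drawn with fresh randomness, and $r_i\sim\mathcal{R}(r_0,A_1^b,\dots,r_{i-1},A_i^b)$. The output is the view $(r_0,A_1^b,r_1,\dots,A_k^b,r_k)$. $\vec{\mathcal{E}}$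 is $(\varepsilon_g,\delta_g)$-DP under $k$-fold adaptive composition if for every adversary $\mathcal{A}$, every $b\in\{0,1\}$ and every (measurable) set $S$ of outputs, $\Pr[\mathrm{AdaComp}(\mathcal{A},\vec{\mathcal{E}},b)\in S]\le e^{\varepsilon_g}\Pr[\mathrm{AdaComp}(\mathcal{A},\vec{\mathcal{E}},1-b)\in S]+\delta_g$. *)

(* Defs.v *)
From HB Require Import structures.
From mathcomp Require Import all_boot all_order all_algebra.
From mathcomp Require Import all_classical all_reals all_analysis.
From mathcomp Require Import measurable_realfun.

Set Implicit Arguments.
Unset Strict Implicit.
Unset Printing Implicit Defensive.
Import Order.TTheory GRing.Theory Num.Theory.
Import numFieldNormedType.Exports.

Local Open Scope classical_set_scope.
Local Open Scope ring_scope.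

(* A mechanism carries its densities (pmf's when [mref] is a counting measure)
   with respect to a reference measure common to all datasets. *)
Record mechanism (X : Type) (d : measure_display) (Y : measurableType d)
    (R : realType) := Mechanism {
  mref : {measure set Y -> \bar R} ;
  mpdf : X -> Y -> R ;
  mpdf_ge0 : forall x y, 0 <= mpdf x y ;
  measurable_mpdf : forall x, measurable_fun setT (mpdf x) ;
  integral_mpdf : forall x, (\int[mref]_y (mpdf x y)%:E = 1)%E }.

Section law.
Context (X : Type) d (Y : measurableType d) (R : realType).
Variables (M : mechanism X Y R) (x : X).

Definition law (B : set Y) : \bar R := (\int[mref M]_(y in B) (mpdf M x y)%:E)%E.

Let law0 : law set0 = 0%E.
Proof. by rewrite /law integral_set0. Qed.

Let law_ge0 B : (0 <= law B)%E.
Proof. by apply: integral_ge0 => y _; rewrite lee_fin mpdf_ge0. Qed.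

Let law_sigma_additive : semi_sigma_additive law.
Proof.
apply: semi_sigma_additive_nng_induced.
- by apply/measurable_EFinP; exact: measurable_mpdf.
- by move=> y; rewrite lee_fin mpdf_ge0.
Qed.

HB.instance Definition _ :=
  isMeasure.Build _ _ _ law law0 law_ge0 law_sigma_additive.

Let lawT : law setT = 1%E.
Proof. exact: integral_mpdf. Qed.

HB.instance Definition _ := Measure_isProbability.Build _ _ _ law lawT.

End law.

Definition bounded_range (X : Type) (nb : X -> X -> Prop)
    d (Y : measurableType d) (R : realType) (eps : R) :
    set (mechanism X Y R) :=
  [set M | forall x x', nb x x' -> forall y1 y2,
     mpdf M x y1 * mpdf M x' y2 <=
     expR eps * (mpdf M x y2 * mpdf M x' y1)].

(* Law of (t, u) where t is drawn from P and then u from k t. *)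
Section pextend.
Context d d' (T : measurableType d) (U : measurableType d') (R : realType).
Variables (P : probability T R) (k : R.-pker T ~> U).

Definition pextend (S : set (T * U)) : \bar R :=
  (\int[P]_t k t (xsection S t))%E.

Let pextend0 : pextend set0 = 0%E.
Proof.
rewrite /pextend; apply: integral0_eq => t _.
by rewrite xsection0 measure0.
Qed.

Let pextend_ge0 S : (0 <= pextend S)%E.
Proof. exact: integral_ge0. Qed.

Let pextend_sigma_additive : semi_sigma_additive pextend.
Proof.
move=> F mF tF mUF; rewrite [X in _ --> X](_ : _ =
    (\sum_(n <oo) pextend (F n))%E).
  by apply: is_cvg_ereal_nneg_natsum => n _; exact: pextend_ge0.
rewrite /pextend -integral_nneseries//.
- apply: eq_integral => t _; rewrite xsection_bigcup measure_bigcup//.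
  + by apply: eq_eseriesl => n; rewrite in_setT.
  + by move=> n _; exact: measurable_xsection.
  + exact: trivIset_xsection.
- by move=> n; apply: measurable_fun_xsection_finite_kernel; rewrite inE; exact: mF.
Qed.

HB.instance Definition _ :=
  isMeasure.Build _ _ _ pextend pextend0 pextend_ge0 pextend_sigma_additive.

Let pextendT : pextend setT = 1%E.
Proof.
rewrite /pextend; under eq_integral => t _.
  rewrite (_ : xsection setT t = setT) ?prob_kernel; last first.
    by apply/seteqP; split => // u _; rewrite /xsection /= in_setT.
  over.
rewrite integral_cst// mul1e; exact: probability_setT.
Qed.

HB.instance Definition _ :=
  Measure_isProbability.Build _ _ _ pextend pextendT.

End pextend.

Section view.
Variables (dY dU : nat -> measure_display).
Variables (Y : forall i, measurableType (dY i)).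
Variables (U : forall i, measurableType (dU i)).

Fixpoint view_display (n : nat) : measure_display :=
  if n is m.+1 then
    measure_prod_display (measure_prod_display (view_display m, dY m), dU m.+1)
  else dU 0.

(* Rounds are numbered from 0, so [view n] is the type of
   (r_0, A_1, r_1, ..., A_n, r_n) with A_j : Y j.-1 and r_j : U j. *)
Fixpoint view (n : nat) : measurableType (view_display n) :=
  match n return measurableType (view_display n) with
  | 0 => U 0
  | m.+1 => (view m * Y m * U m.+1)%type
  end.

End view.

(* In round i the deterministic part of the adversary selects, as a function of
   the current view, the neighboring datasets [data i h false] and
   [data i h true] and the mechanism [mech i h] in the class [E i].
   [measurable_law] says that the outcome of round i has a conditional law given
   the view, i.e., that the game is a well-defined random experiment. *)
Record adversary (R : realType) (X : Type) (nb : X -> X -> Prop) (k : nat)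
    (dY dU : nat -> measure_display)
    (Y : forall i, measurableType (dY i)) (U : forall i, measurableType (dU i))
    (E : forall i : 'I_k, set (mechanism X (Y i) R)) := Adversary {
  rand0 : probability (U 0) R ;
  rand : forall i : 'I_k, R.-pker (view Y U i * Y i)%type ~> U i.+1 ;
  data : forall i : 'I_k, view Y U i -> bool -> X ;
  mech : forall i : 'I_k, view Y U i -> mechanism X (Y i) R ;
  data_nb : forall (i : 'I_k) (h : view Y U i), nb (data h false) (data h true) ;
  mech_in : forall (i : 'I_k) (h : view Y U i), E i (mech h) ;
  measurable_law : forall (i : 'I_k) b (B : set (Y i)), measurable B ->
    measurable_fun setT (fun h : view Y U i => law (mech h) (data h b) B) }.

Section game.
Context (R : realType) (X : Type) (nb : X -> X -> Prop) (k : nat).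
Context (dY dU : nat -> measure_display).
Context (Y : forall i, measurableType (dY i)).
Context (U : forall i, measurableType (dU i)).
Context (E : forall i : 'I_k, set (mechanism X (Y i) R)).
Variables (A : adversary nb U E) (b : bool).

Definition outcome (i : 'I_k) (h : view Y U i) : {measure set (Y i) -> \bar R} :=
  law (mech A h) (data A h b).

HB.instance Definition _ (i : 'I_k) :=
  isKernel.Build _ _ _ _ R (outcome (i := i)) (@measurable_law _ _ _ _ _ _ _ _ _ A i b).

Let outcomeT (i : 'I_k) h : @outcome i h setT = 1%E.
Proof. exact: probability_setT. Qed.

HB.instance Definition _ (i : 'I_k) :=
  Kernel_isProbability.Build _ _ _ _ R (outcome (i := i)) (@outcomeT i).

Definition outcome_kernel (i : 'I_k) : R.-pker (view Y U i) ~> Y i :=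
  outcome (i := i).

Fixpoint run (n : nat) : (n <= k)%N -> probability (view Y U n) R :=
  match n return (n <= k)%N -> probability (view Y U n) R with
  | 0 => fun _ => rand0 A
  | m.+1 => fun lt_mk : (m < k)%N =>
      let i := Ordinal lt_mk in
      pextend (pextend (run (ltnW lt_mk)) (outcome_kernel i)) (rand A i)
  end.

Definition AdaComp : probability (view Y U k) R := run (leqnn k).

End game.

Definition DP_adaptive_composition (R : realType) (X : Type)
    (nb : X -> X -> Prop) (k : nat) (dY : nat -> measure_display)
    (Y : forall i, measurableType (dY i))
    (E : forall i : 'I_k, set (mechanism X (Y i) R)) (eps delta : R) : Prop :=
  forall (dU : nat -> measure_display) (U : forall i, measurableType (dU i))
    (A : adversary nb U E) (b : bool) (S : set (view Y U k)), measurable S ->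
  (AdaComp A b S <= (expR eps)%:E * AdaComp A (~~ b) S + delta%:E)%E.

Section bounds.
Context (R : realType).

Definition p_eps (eps t : R) : R :=
  (expR (- t) - expR (- eps)) / (1 - expR (- eps)).

Definition h_eps (eps l : R) : R :=
  sup [set l * (eps - t) + ln (1 + p_eps eps t * (expR (- (l * eps)) - 1))
      | t in `[0, eps]].

Definition delta_g (k : nat) (eps : 'I_k -> R) (eg : R) : R :=
  inf [set expR (- (l * eg) + \sum_(i < k) h_eps (eps i) l)
      | l in [set l | 0 < l]].

End bounds.

(* Main.v *)
Require Import Defs.
From HB Require Import structures.
From mathcomp Require Import all_boot all_order all_algebra.
From mathcomp Require Import all_classical all_reals all_analysis.
From mathcomp Require Import measurable_realfun ring lra.

Set Implicit Arguments.
Unset Strict Implicit.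
Unset Printing Implicit Defensive.
Import Order.TTheory GRing.Theory Num.Theory.
Import numFieldNormedType.Exports.

Local Open Scope classical_set_scope.
Local Open Scope ring_scope.

(** The conditional densities of the outcomes need not depend measurably on the
    view, and the reference measures vary with it, so no likelihood ratio of the
    whole game is formed.  The Renyi divergence is bounded in dual (Hoelder)
    form instead: with theta = l / (1 + l),
    [E_P (g ^ theta) <= c (E_Q g) ^ theta] for all measurable g with values in [0, 1].  This passes to compositions,
    multiplying the constants, by applying it first to the conditional laws and
    then to the conditional Q-expectation of g.  For one bounded-range mechanism
    the likelihood ratio lies in [e^-t, e^(eps - t)] for some t in [0, eps];
    bounding r^(1 + l) by its chord there gives the constant
    exp (h_eps (l) / (1 + l)).  Taking for g the indicator of S, Young's
    inequality turns the product of the constants into the additive term. *)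

(** * Integrals against laws of mechanisms and of extended views *)

Section integral_functional.
Local Open Scope ereal_scope.
Context d (T : measurableType d) (R : realType).
Variables (mu : {measure set T -> \bar R}) (I : (T -> \bar R) -> \bar R).
Hypothesis I_indic : forall A, measurable A -> I (EFin \o \1_A) = mu A.
Hypothesis I_add : forall f g : T -> \bar R,
  measurable_fun setT f -> (forall x, 0 <= f x) ->
  measurable_fun setT g -> (forall x, 0 <= g x) ->
  I (fun x => f x + g x) = I f + I g.
Hypothesis I_scale : forall (r : R) (f : T -> \bar R), (0 <= r)%R ->
  measurable_fun setT f -> (forall x, 0 <= f x) ->
  I (fun x => r%:E * f x) = r%:E * I f.
Hypothesis I_cvg : forall f_ : (T -> \bar R)^nat,
  (forall n, measurable_fun setT (f_ n)) -> (forall n x, 0 <= f_ n x) ->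
  (forall x, nondecreasing_seq (f_ ^~ x)) ->
  I (f_ n) @[n --> \oo] --> I (fun x => limn (f_ ^~ x)).

Import HBNNSimple.

Lemma functional_nnsfunE (f : {nnsfun T >-> R}) :
  I (EFin \o f) = \int[mu]_x (f x)%:E.
Proof.
have mindic r :
    measurable_fun setT (fun x => (\1_(f @^-1` [set r]) x)%:E : \bar R).
  by apply/measurable_EFinP.
have I_sum (s : seq R) : all (fun r => 0 <= r)%R s ->
    I (fun x => \sum_(r <- s) r%:E * (\1_(f @^-1` [set r]) x)%:E) =
    \sum_(r <- s) r%:E * mu (f @^-1` [set r]).
  elim: s => [_|r s IHs /= /andP[r0 s0]].
    rewrite big_nil; under eq_fun do rewrite big_nil.
    transitivity (I (EFin \o \1_(set0 : set T))); last first.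
      by rewrite I_indic ?measure0.
    by congr I; apply/funext => x; rewrite /= indic0.
  rewrite big_cons; under eq_fun do rewrite big_cons.
  rewrite I_add ?IHs ?I_scale ?I_indic//.
  - exact: measurable_funeM.
  - by move=> x; rewrite mule_ge0 ?lee_fin.
  - apply: emeasurable_sum => r' _; exact: measurable_funeM.
  - move=> x; rewrite big_seq; apply: sume_ge0 => r' r's.
    by rewrite mule_ge0 ?lee_fin// (allP s0).
rewrite integral_nnsfun// patch_setT sintegralE fsbig_finite//= -I_sum.
  congr I; apply/funext => x /=; rewrite fimfunE -fsumEFin// fsbig_finite//=.
apply/allP => r; rewrite in_fset_set// inE => -[x _ <-].
exact: fun_ge0.
Qed.

(** Standard machine: on simple functions [I] is a finite sum over level sets, and monotone
    continuity carries the equality to increasing limits. *)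
Lemma functional_integralE (f : T -> \bar R) :
  measurable_fun setT f -> (forall x, 0 <= f x) -> I f = \int[mu]_x f x.
Proof.
move=> mf f0.
pose f_ n := nnsfun_approx measurableT mf n.
have mf_ n : measurable_fun setT (fun x => (f_ n x)%:E : \bar R).
  exact/measurable_EFinP.
have f_0 n x : 0 <= (f_ n x)%:E by rewrite lee_fin.
have nd x : nondecreasing_seq (fun n => (f_ n x)%:E).
  by move=> m n mn; rewrite lee_fin; exact/lefP/nd_nnsfun_approx.
have -> : f = fun x => limn (fun n => (f_ n x)%:E).
  by apply/funext => x; apply/esym/cvg_lim => //; exact: cvg_nnsfun_approx.
have := I_cvg mf_ f_0 nd.
under eq_fun do rewrite functional_nnsfunE.
move=> /cvg_lim <-//; rewrite monotone_convergence//.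
Qed.

End integral_functional.

(** The right-hand side, as a functional of [f], meets the conditions of [functional_integralE] and
    gives the law on indicators. *)
Lemma integral_law (X : Type) d (Y : measurableType d) (R : realType)
    (M : mechanism X Y R) (x : X) (f : Y -> \bar R) :
  measurable_fun setT f -> (forall y, (0 <= f y)%E) ->
  (\int[law M x]_y f y = \int[mref M]_y (f y * (mpdf M x y)%:E))%E.
Proof.
have mp : measurable_fun setT (fun y => (mpdf M x y)%:E).
  by apply/measurable_EFinP; exact: measurable_mpdf.
have p0 y : (0 <= (mpdf M x y)%:E)%E by rewrite lee_fin mpdf_ge0.
move=> mf f0; apply/esym.
apply: (functional_integralE (mu := law M x)
  (I := fun f => (\int[mref M]_y (f y * (mpdf M x y)%:E))%E)) => //.
- move=> A mA; rewrite /= /law [RHS]integral_mkcond; apply: eq_integral => y _.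
  by rewrite /= epatch_indic/= muleC.
- move=> {mf f0}f g mf f0 mg g0; rewrite -ge0_integralD//.
  + by apply: eq_integral => y _; rewrite ge0_muleDl.
  + by move=> y _; rewrite mule_ge0.
  + exact: emeasurable_funM.
  + by move=> y _; rewrite mule_ge0.
  + exact: emeasurable_funM.
- move=> r {mf f0}f r0 mf f0; rewrite -ge0_integralZl//.
  + by apply: eq_integral => y _; rewrite muleA.
  + exact: emeasurable_funM.
  + by move=> y _; rewrite mule_ge0.
- move=> f_ mf_ f_0 nd.
  under [X in _ --> X]eq_integral => y _.
    rewrite (_ : limn (f_ ^~ y) * _ =
        limn (fun n => f_ n y * (mpdf M x y)%:E))%E; last first.
      apply/esym/cvg_lim => //; apply: cvgeZr => //.
      exact: ereal_nondecreasing_is_cvgn.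
    over.
  apply: cvg_monotone_convergence => //.
  + by move=> n; exact: emeasurable_funM.
  + by move=> n y _; rewrite mule_ge0.
  + by move=> y _ m n mn; rewrite lee_wpmul2r// nd.
Qed.

Lemma integral_pextend d d' (T : measurableType d) (U : measurableType d')
    (R : realType) (P : probability T R) (k : R.-pker T ~> U)
    (f : T * U -> \bar R) :
  measurable_fun setT f -> (forall z, (0 <= f z)%E) ->
  (\int[pextend P k]_z f z = \int[P]_t \int[k t]_u f (t, u))%E.
Proof.
have mf2 (h : T * U -> \bar R) t : measurable_fun setT h ->
    measurable_fun setT (fun u => h (t, u)).
  by move=> mh; exact: measurableT_comp.
have mint (h : T * U -> \bar R) : measurable_fun setT h ->
    (forall z, (0 <= h z)%E) ->
    measurable_fun setT (fun t => \int[k t]_u h (t, u))%E.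
  by move=> mh h0; exact: measurable_fun_integral_finite_kernel.
move=> mf f0; apply/esym.
apply: (functional_integralE (mu := pextend P k)
  (I := fun f => (\int[P]_t \int[k t]_u f (t, u))%E)) => //.
- move=> A mA; rewrite /= /pextend; apply: eq_integral => t _.
  rewrite -[in RHS](setIT (xsection A t)) -integral_indic//; last first.
    exact: measurable_xsection.
  apply: eq_integral => u _; rewrite /= !indicE mem_xsection//.
- move=> {mf f0}f g mf f0 mg g0; rewrite -ge0_integralD//.
  + apply: eq_integral => t _; rewrite -ge0_integralD//; exact: mf2.
  + by move=> t _; rewrite integral_ge0.
  + exact: mint.
  + by move=> t _; rewrite integral_ge0.
  + exact: mint.
- move=> r {mf f0}f r0 mf f0; rewrite -ge0_integralZl//.
  + apply: eq_integral => t _; rewrite -ge0_integralZl//; exact: mf2.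
  + exact: mint.
  + by move=> t _; rewrite integral_ge0.
- move=> f_ mf_ f_0 nd.
  under [X in _ --> X]eq_integral => t _.
    rewrite monotone_convergence//; last by move=> n; exact: mf2.
    over.
  apply: cvg_monotone_convergence => //.
  + by move=> n; exact: mint.
  + by move=> n t _; rewrite integral_ge0.
  + move=> t _ m n mn; apply: ge0_le_integral => //; try exact: mf2.
    by move=> u _; exact: nd.
Qed.

(* When [P] has density [r] with respect to [Q], the least such [c] is the norm
   of [r] in L^(1 / (1 - theta)) (Q), i.e. exp ((1 - theta) * l * D) for D the
   Renyi divergence of order 1 + l, theta = l / (1 + l). *)
Definition power_dominated d (T : measurableType d) (R : realType)
    (theta c : R) (P Q : {measure set T -> \bar R}) : Prop :=
  forall g : T -> R, measurable_fun setT g -> (forall x, 0 <= g x <= 1) ->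
  (\int[P]_x (g x `^ theta)%:E <= c%:E * (\int[Q]_x (g x)%:E) `^ theta)%E.

(** * Power domination: Hoelder bound and composition *)

Section power_dominated_theory.
Context (R : realType) (theta : R).
Hypothesis theta01 : 0 < theta < 1.

(** Hoelder's inequality with exponents [1 / theta] and [1 / (1 - theta)] for the factors
    [(g q) ^ theta] and [w ^ (1 - theta)]. The weight [w] majorizes [q (p / q) ^ (1 / (1 - theta))],
    expressed without division because [q] may vanish. *)
Lemma power_dominated_density d (T : measurableType d)
    (mu : {measure set T -> \bar R}) (p q w g : T -> R) (c : R) :
  measurable_fun setT q -> (forall x, 0 <= q x) ->
  measurable_fun setT p -> (forall x, 0 <= p x) ->
  measurable_fun setT w -> (forall x, 0 <= w x) ->
  (forall x, p x <= q x `^ theta * w x `^ (1 - theta)) ->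
  (\int[mu]_x (w x)%:E = c%:E)%E ->
  measurable_fun setT g -> (forall x, 0 <= g x) ->
  (\int[mu]_x (g x `^ theta * p x)%:E <=
    (c `^ (1 - theta))%:E * (\int[mu]_x (g x * q x)%:E) `^ theta)%E.
Proof.
move: theta01 => /andP[theta_gt0 theta_lt1].
move=> mq q0 mp p0 mw w0 pqw wc mg g0.
have theta'_gt0 : 0 < 1 - theta by rewrite subr_gt0.
have mpow (f : T -> R) (r : R) : measurable_fun setT f ->
    measurable_fun setT (fun x => f x `^ r).
  exact: (@measurableT_comp _ _ _ _ _ _ (@powR R ^~ r)).
pose F x := (g x * q x) `^ theta.
pose G x := w x `^ (1 - theta).
have mF : measurable_fun setT F by apply: mpow; exact: measurable_funM.
have mG : measurable_fun setT G by exact: mpow.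
have FE x : F x = (g x * q x) `^ theta by [].
have GE x : G x = w x `^ (1 - theta) by [].
clearbody F G.
have := @hoelder _ _ _ mu F G theta^-1 (1 - theta)^-1 mF mG.
rewrite !invr_gt0 !invrK => /(_ theta_gt0 theta'_gt0).
rewrite addrC subrK => /(_ erefl).
rewrite Lnorm1 unlock /= !invrK.
have -> : (\int[mu]_x (`|F x| `^ theta^-1)%:E = \int[mu]_x (g x * q x)%:E)%E.
  apply: eq_integral => x _; rewrite FE ger0_norm ?powR_ge0// -powRrM.
  by rewrite mulfV ?gt_eqF// powRr1// mulr_ge0.
have -> : (\int[mu]_x (`|G x| `^ (1 - theta)^-1)%:E = c%:E)%E.
  rewrite -wc; apply: eq_integral => x _; rewrite GE ger0_norm ?powR_ge0//.
  by rewrite -powRrM mulfV ?gt_eqF// powRr1.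
rewrite muleC => /(le_trans _); apply; apply: ge0_le_integral => //.
- by move=> x _; rewrite lee_fin mulr_ge0 ?powR_ge0.
- by apply/measurable_EFinP/measurable_funM => //; exact: mpow.
- by apply/measurable_EFinP/measurableT_comp => //; exact: measurable_funM.
- move=> x _; rewrite lee_fin FE GE ger0_norm ?mulr_ge0 ?powR_ge0// powRM// -mulrA.
  by rewrite ler_wpM2l ?powR_ge0.
Qed.

(** Jensen's inequality for a concave power, as the Hoelder bound with all densities 1. Randomness
    common to both games thus costs nothing. *)
Lemma power_dominated_refl d (T : measurableType d) 
    (P : {measure set T -> \bar R}) :
  P setT = 1%E -> power_dominated theta 1 P P.
Proof.
move=> PT g mg g01.
have g0 x : 0 <= g x by case/andP: (g01 x).
under [X in (X <= _)%E]eq_integral do rewrite -[_ `^ _]mulr1.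
under [X in (_ * X `^ _)%E]eq_integral do rewrite -[g _]mulr1.
rewrite (_ : 1%:E = (1 `^ (1 - theta))%:E); last by rewrite powR1.
apply: (power_dominated_density (q := cst 1) (w := cst 1)) => //.
- by move=> x; rewrite /= !powR1 mulr1.
- transitivity (1 * P setT)%E; first exact: (integral_cst P measurableT 1%E).
  by rewrite mul1e.
Qed.

Lemma power_dominated_pextend d d' (T : measurableType d)
    (U : measurableType d') (c1 c2 : R) (P Q : probability T R)
    (k l : R.-pker T ~> U) :
  0 <= c2 -> power_dominated theta c1 P Q ->
  (forall t, power_dominated theta c2 (k t) (l t)) ->
  power_dominated theta (c2 * c1) (pextend P k) (pextend Q l).
Proof.
move=> c2_ge0 PQ kl g mg g01.
have g0 x : 0 <= g x by case/andP: (g01 x).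
have mgt t : measurable_fun setT (fun u => g (t, u)) by exact: measurableT_comp.
have mEg : measurable_fun setT (EFin \o g) by exact/measurable_EFinP.
have mpow : measurable_fun setT (fun x => g x `^ theta).
  exact: (@measurableT_comp _ _ _ _ _ _ (@powR R ^~ theta)).
have mint (k' : R.-pker T ~> U) (f : T * U -> R) : measurable_fun setT f ->
    (forall z, (0 <= f z)) ->
    measurable_fun setT (fun t => \int[k' t]_u (f (t, u))%:E)%E.
  move=> mf f0; apply: (measurable_fun_integral_finite_kernel (EFin \o f)) => //.
  exact/measurable_EFinP.
have int01 t : (0 <= \int[l t]_u (g (t, u))%:E <= 1)%E.
  rewrite integral_ge0//=; last by move=> u _; rewrite lee_fin.
  apply: (@le_trans _ _ (\int[l t]_u 1)%E).
    apply: ge0_le_integral => //; first by move=> u _; rewrite lee_fin.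
      exact/measurable_EFinP.
    by move=> u _; rewrite lee_fin; case/andP: (g01 (t, u)).
  by rewrite integral_cst// mul1e prob_kernel.
(* The conditional mean of [g] under [l] again lies in [0, 1], so [fine] loses nothing and [m] is a
   test function for [PQ]. *)
pose m t := fine (\int[l t]_u (g (t, u))%:E)%E.
have mE t : ((m t)%:E = \int[l t]_u (g (t, u))%:E)%E.
  have /andP[i0 i1] := int01 t.
  by rewrite fineK// ge0_fin_numE// (le_lt_trans i1)// ltry.
have mm : measurable_fun setT m.
  apply/measurable_EFinP.
  rewrite (_ : EFin \o m = fun t => \int[l t]_u (g (t, u))%:E)%E.
    exact: (mint l g).
  by apply/funext => t; rewrite /= mE.
have m01 t : 0 <= m t <= 1 by rewrite -!lee_fin mE.
have mmpow : measurable_fun setT (fun t => m t `^ theta).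
  exact: (@measurableT_comp _ _ _ _ _ _ (@powR R ^~ theta)).
rewrite integral_pextend//; last 2 first.
  exact/measurable_EFinP.
  by move=> z; rewrite lee_fin powR_ge0.
rewrite (integral_pextend Q l (f := EFin \o g))//.
under [X in (_ * X `^ _)%E]eq_integral do rewrite -mE.
apply: (@le_trans _ _ (\int[P]_t (c2%:E * (m t `^ theta)%:E))%E).
  apply: ge0_le_integral => //.
  - by move=> t _; rewrite integral_ge0// => u _; rewrite lee_fin powR_ge0.
  - by apply: (mint k (fun z => g z `^ theta)) => // z; exact: powR_ge0.
  - by apply: measurable_funeM; exact/measurable_EFinP.
  - move=> t _; rewrite -poweR_EFin mE; exact: kl.
rewrite ge0_integralZl//; last 2 first.
  exact/measurable_EFinP.
  by move=> t _; rewrite lee_fin powR_ge0.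
by rewrite EFinM -muleA lee_wpmul2l ?lee_fin// PQ.
Qed.

End power_dominated_theory.

(** * Likelihood ratio of one bounded-range mechanism *)

Lemma powR_le_chord (R : realType) (al a b x : R) :
  1 <= al -> 0 <= a -> a < b -> a <= x <= b ->
  x `^ al <= ((b - x) * a `^ al + (x - a) * b `^ al) / (b - a).
Proof.
move=> al1 a0 ab /andP[ax xb].
have ba : 0 < b - a by rewrite subr_gt0.
(* The weight that writes [x] as a convex combination of [a] and [b]. *)
pose s := (b - x) / (b - a).
have s0 : 0 <= s by rewrite divr_ge0 ?subr_ge0// ltW.
have s1 : s <= 1 by rewrite ler_pdivrMr// mul1r lerD2l lerN2.
have : (s * a + (1 - s) * b) `^ al <= s * a `^ al + (1 - s) * b `^ al.
  by apply: (convex_powR al1 (Itv01 s0 s1)) => /=;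
    rewrite inE/= in_itv/= ?a0 ?(le_trans a0 (ltW ab)).
rewrite (_ : s * a + (1 - s) * b = x); last by rewrite /s; field; rewrite gt_eqF.
move/le_trans; apply; rewrite le_eqVlt; apply/orP; left; apply/eqP.
by rewrite /s; field; rewrite gt_eqF.
Qed.

Section bounded_ratio.
Context d (T : measurableType d) (R : realType).
Variables (mu : {measure set T -> \bar R}) (p q : T -> R) (F : R).
Hypotheses (p_ge0 : forall y, 0 <= p y) (q_ge0 : forall y, 0 <= q y).
Hypotheses (mp : measurable_fun setT p) (mq : measurable_fun setT q).
Hypothesis p1 : (\int[mu]_y (p y)%:E = 1)%E.
Hypothesis q1 : (\int[mu]_y (q y)%:E = 1)%E.
Hypothesis F_gt1 : 1 < F.
Hypothesis pqF : forall y1 y2, p y1 * q y2 <= F * (p y2 * q y1).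

(** Take for [a] the infimum of [p / q] over [q > 0]. Ratios differ by a factor at most [F], and
    since both densities have mass 1, the value 1 lies between [a] and [a * F]. *)
Lemma bounded_ratio_ex_itv : exists2 a,
  [/\ 0 < a, a <= 1 & 1 <= a * F] & forall y, a * q y <= p y <= a * F * q y.
Proof.
have F_gt0 : 0 < F by exact: lt_trans F_gt1.
have [y0 qy0] : exists y, 0 < q y.
  apply: contrapT => /forallNP nq; move: q1; rewrite integral0_eq => [/eqP|y _].
    by rewrite eqe eq_sym oner_eq0.
  by congr EFin; apply/eqP; rewrite eq_le q_ge0 leNgt andbT; apply/negP/nq.
have p0 y : q y = 0 -> p y = 0.
  move=> qy; have := pqF y y0; rewrite qy !mulr0 pmulr_lle0// => py.
  by apply/eqP; rewrite eq_le py p_ge0.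
pose S := [set p y / q y | y in [set y | 0 < q y]].
have lbS : lbound S 0 by move=> _ [y /= qy <-]; rewrite divr_ge0.
have S0 : S !=set0 by exists (p y0 / q y0), y0.
pose a := inf S.
have a0 : 0 <= a by exact: lb_le_inf.
have aq y : a * q y <= p y.
  have := q_ge0 y; rewrite le_eqVlt => /predU1P[<-|qy]; first by rewrite mulr0.
  by rewrite -ler_pdivlMr//; apply: ge_inf; [exists 0|exists y].
have paF y : p y <= a * F * q y.
  have := q_ge0 y; rewrite le_eqVlt => /predU1P[qy|qy].
    by rewrite -qy mulr0 p0.
  (* By [pqF], [p y / F / q y] is a lower bound of all ratios, hence at most their infimum. *)
  rewrite mulrAC -ler_pdivrMr// -ler_pdivrMr//.
  apply: lb_le_inf => // _ [z /= qz <-].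
  rewrite ler_pdivrMr// ler_pdivrMr//.
  rewrite (_ : p z / q z * q y * F = F * (p z * q y) / q z); last by ring.
  by rewrite ler_pdivlMr.
have intZ c : 0 <= c -> (\int[mu]_y (c * q y)%:E = c%:E)%E.
  move=> c0; under eq_integral do rewrite EFinM.
  rewrite ge0_integralZl ?q1 ?mule1//; first exact/measurable_EFinP.
  by move=> y _; rewrite lee_fin.
have a1 : a <= 1.
  rewrite -lee_fin -(intZ a)// -p1; apply: ge0_le_integral => //.
  - by move=> y _; rewrite lee_fin mulr_ge0.
  - by apply/measurable_EFinP; exact: measurable_funM.
  - exact/measurable_EFinP.
  - by move=> y _; rewrite lee_fin.
have aF : 1 <= a * F.
  rewrite -lee_fin -(intZ (a * F)) ?mulr_ge0 ?(ltW F_gt0)// -p1.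
  apply: ge0_le_integral => //.
  - by move=> y _; rewrite lee_fin.
  - exact/measurable_EFinP.
  - by apply/measurable_EFinP; exact: measurable_funM.
  - by move=> y _; rewrite lee_fin.
exists a => [|y]; last by rewrite aq paF.
split=> //; rewrite lt_neqAle a0 andbT; apply/eqP => a_eq0.
by move: aF; rewrite -a_eq0 mul0r ler10.
Qed.

(* The constant is the mean of [r ^ (1 + l)] for the ratio [r] of mean 1 under
   [q] taking only the values [a] and [a * F], extremal by convexity. *)
Lemma bounded_ratio_power_dominated (l : R) : 0 < l ->
  exists2 a, [/\ 0 < a, a <= 1 & 1 <= a * F] &
    forall g : T -> R, measurable_fun setT g -> (forall x, 0 <= g x) ->
    (\int[mu]_x (g x `^ (l / (1 + l)) * p x)%:E <=
      ((((a * F - 1) * a `^ (1 + l) + (1 - a) * (a * F) `^ (1 + l)) /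
          (a * F - a)) `^ (1 + l)^-1)%:E *
      (\int[mu]_x (g x * q x)%:E) `^ (l / (1 + l)))%E.
Proof.
move=> l_gt0; have [a [a_gt0 a_le1 aF1] pa] := bounded_ratio_ex_itv.
exists a => //.
have l1 : 0 < 1 + l by rewrite addr_gt0.
set theta := l / (1 + l).
have theta01 : 0 < theta < 1.
  by rewrite divr_gt0//= ltr_pdivrMr// mul1r ltrDr.
have theta' : (1 + l)^-1 = 1 - theta by rewrite /theta; field; rewrite gt_eqF.
set b := a * F in aF1 pa *.
have ab : a < b by rewrite /b ltr_pMr.
have ba : 0 < b - a by rewrite subr_gt0.
(* [w] is [q] times the chord of [r ^ (1 + l)] over [[a, b]] at [r = p / q]. It is linear in [p] and
   [q], so its integral depends only on their unit masses. *)
pose w y := ((b * q y - p y) * a `^ (1 + l) + (p y - a * q y) * b `^ (1 + l))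
  / (b - a).
have wE y : w y = (b * a `^ (1 + l) - a * b `^ (1 + l)) / (b - a) * q y
    + (b `^ (1 + l) - a `^ (1 + l)) / (b - a) * p y.
  by rewrite /w; field; rewrite gt_eqF.
have w_ge0 y : 0 <= w y.
  have /andP[aqp pbq] := pa y.
  by rewrite divr_ge0 ?(ltW ba)// addr_ge0// mulr_ge0 ?powR_ge0 ?subr_ge0.
have integr (f : T -> R) : (forall y, 0 <= f y) -> measurable_fun setT f ->
    (\int[mu]_y (f y)%:E = 1)%E -> mu.-integrable setT (EFin \o f).
  move=> f0 mf f1; apply/integrableP; split; first exact/measurable_EFinP.
  under eq_integral do rewrite /= ger0_norm//.
  by rewrite f1 ltry.
move=> g mg g0; rewrite theta'.
apply: (power_dominated_density theta01 (q := q) (w := w)) => //.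
- rewrite (_ : w = fun y => (b * a `^ (1 + l) - a * b `^ (1 + l)) / (b - a) * q y
    + (b `^ (1 + l) - a `^ (1 + l)) / (b - a) * p y); last exact/funext.
  by apply: measurable_funD; exact: measurable_funM.
- move=> y; have /andP[aqp pbq] := pa y.
  (* Where [q] vanishes the upper bound forces [p = 0]; elsewhere the chord bound at [p / q] is
     raised to the power [1 / (1 + l)]. *)
  have := q_ge0 y; rewrite le_eqVlt => /predU1P[qy|qy].
    rewrite (_ : p y = 0) ?mulr_ge0 ?powR_ge0//.
    by apply/eqP; rewrite eq_le p_ge0 andbT; move: pbq; rewrite -qy mulr0.
  have := @powR_le_chord R (1 + l) a b (p y / q y) _ (ltW a_gt0) ab.
  rewrite lerDl (ltW l_gt0) ler_pdivlMr// ler_pdivrMr// aqp pbq.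
  move=> /(_ isT isT).
  rewrite (_ : _ / (b - a) = w y / q y); last first.
    by rewrite /w; field; rewrite !gt_eqF.
  move=> /(ge0_ler_powR (r := (1 + l)^-1)).
  rewrite !nnegrE powR_ge0 divr_ge0// invr_ge0 (ltW l1) => /(_ isT isT isT).
  rewrite -powRrM mulfV ?gt_eqF// powRr1 ?divr_ge0// ler_pdivrMr//.
  move=> /le_trans; apply; rewrite theta' powRM ?invr_ge0//.
  rewrite [leLHS](_ : _ = q y `^ theta * w y `^ (1 - theta))//.
  have {2}-> : q y = q y `^ theta * q y `^ (1 - theta).
    rewrite -powRD; last by rewrite (gt_eqF qy) implybT.
    by rewrite [theta + _]addrC subrK powRr1.
  rewrite mulrCA; congr (_ * _).
  by rewrite -mulrA -powRM ?invr_ge0// mulVf ?gt_eqF// powR1 mulr1.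
- under eq_integral do rewrite wE EFinD !EFinM.
  rewrite integralD//; last 2 first.
  + by apply: integrableZl => //; exact: integr.
  + by apply: integrableZl => //; exact: integr.
  rewrite !integralZl//; [|exact: integr|exact: integr].
  rewrite p1 q1 !mule1 -EFinD; congr EFin.
  by field; rewrite gt_eqF.
Qed.

End bounded_ratio.

(** * The chord constant and [h_eps] *)

Lemma le_expR_h_eps (R : realType) (eps l t : R) : 0 < eps -> 0 < l ->
  0 <= t <= eps ->
  expR (l * (eps - t)) * (1 + p_eps eps t * (expR (- (l * eps)) - 1)) <=
  expR (h_eps eps l).
Proof.
move=> eps0 l0.
have e1 : expR (- eps) < 1 by rewrite expR_lt1 oppr_lt0.
have p01 s : 0 <= s <= eps -> 0 <= p_eps eps s <= 1.
  move=> /andP[s0 se]; rewrite /p_eps divr_ge0 ?subr_ge0 ?ler_expR ?lerN2 ?(ltW e1)//=.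
  by rewrite ler_pdivrMr ?subr_gt0// mul1r lerD2r -expR0 ler_expR oppr_le0.
have L1 : expR (- (l * eps)) < 1 by rewrite expR_lt1 oppr_lt0 mulr_gt0.
have arg s : 0 <= s <= eps ->
    0 < 1 + p_eps eps s * (expR (- (l * eps)) - 1) <= 1.
  move=> /p01/andP[ps0 ps1]; apply/andP; split; last first.
    by rewrite gerDl mulr_ge0_le0// subr_le0 ltW.
  have := expR_gt0 (- (l * eps)); move: L1 ps0 ps1.
  move: (p_eps _ _) (expR _) => u v; nra.
move=> t0e; have /andP[arg0 _] := arg _ t0e.
move: arg0; rewrite -lnK_eq => /eqP <-; rewrite -expRD ler_expR.
apply: ub_le_sup; last by exists t => //=; rewrite in_itv.
(* [l * eps] is an upper bound since the logarithm is nonpositive and [s >= 0]; on an unbounded set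
   [sup] would be a default value. *)
exists (l * eps); apply/ubP => _ [s /= + <-]; rewrite in_itv/= => s0e.
have /andP[_ arg1] := arg _ s0e.
have := ln_le0 arg1; case/andP: s0e => s0 _; nra.
Qed.

(** At [t = - ln a] the constant is exactly the exponential of the expression whose supremum is
    [h_eps]. It is the mean of [r ^ (1 + l)] under Q for a two-valued ratio r = dP/dQ, hence the
    mean of [r ^ l] under P, where the lower value [a] has probability [p_eps eps t]. *)
Lemma chord_le_expR_h_eps (R : realType) (eps l a : R) : 0 < eps -> 0 < l ->
  0 < a -> a <= 1 -> 1 <= a * expR eps ->
  ((a * expR eps - 1) * a `^ (1 + l) + (1 - a) * (a * expR eps) `^ (1 + l)) /
    (a * expR eps - a) <= expR (h_eps eps l).
Proof.
move=> eps0 l0 a0 a1 aF1.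
pose t := - ln a.
have aE : expR (- t) = a by rewrite /t opprK lnK.
have t0e : 0 <= t <= eps.
  rewrite /t oppr_ge0 ln_le0//= -ler_expR -/t expRN -(ler_pM2l a0).
  by rewrite lnK ?posrE// mulfV ?gt_eqF.
apply: le_trans (le_expR_h_eps eps0 l0 t0e).
have F1 : 1 < expR eps by rewrite expR_gt1.
rewrite /p_eps aE.
have pow1l x : 0 < x -> x `^ (1 + l) = x * expR (l * ln x).
  move=> x0; rewrite powRD; last by rewrite (gt_eqF x0) implybT.
  by rewrite powRr1 ?ltW// /powR gt_eqF.
rewrite !pow1l ?mulr_gt0 ?expR_gt0//.
have lnaF : ln (a * expR eps) = eps - t.
  by rewrite lnM ?posrE ?expR_gt0// expRK addrC /t opprK.
have lna : ln a = - t by rewrite /t opprK.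
clearbody t; rewrite lnaF lna mulrN.
rewrite mulrBr expRB !expRN.
have := expR_gt0 (l * eps); have := expR_gt0 (l * t); move: F1.
rewrite le_eqVlt; set F := expR eps; set G := expR (l * t); set H := expR (l * eps).
move=> F1 G0 H0; apply/orP; left; apply/eqP; field.
by rewrite !gt_eqF ?subr_gt0 ?ltr_pMr// (lt_trans _ F1).
Qed.

(** The endpoint [a] depends on the mechanism and the datasets; the supremum in [h_eps] replaces it
    by a constant depending only on [eps] and [l]. *)
Lemma bounded_range_power_dominated (R : realType) (X : Type)
    (nb : X -> X -> Prop) d (Y : measurableType d) (eps l : R)
    (M : mechanism X Y R) (x x' : X) : 0 < eps -> 0 < l ->
  bounded_range nb eps M -> nb x x' ->
  power_dominated (l / (1 + l)) (expR (h_eps eps l / (1 + l)))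
    (law M x) (law M x').
Proof.
move=> eps0 l0 Mbr nbxx' g mg g01.
have g0 y : 0 <= g y by case/andP: (g01 y).
have [a [a0 a1 aF]] := bounded_ratio_power_dominated (mpdf_ge0 M x)
  (mpdf_ge0 M x') (measurable_mpdf M x) (measurable_mpdf M x')
  (integral_mpdf M x) (integral_mpdf M x') (eqbRL (expR_gt1 _) eps0)
  (Mbr _ _ nbxx') l0.
move=> /(_ g mg g0) Mg.
have mgpow : measurable_fun setT (fun y => g y `^ (l / (1 + l))).
  exact: (@measurableT_comp _ _ _ _ _ _ (@powR R ^~ (l / (1 + l)))).
rewrite !integral_law//; try exact/measurable_EFinP; last first.
  by move=> y; rewrite lee_fin powR_ge0.
apply: (le_trans Mg); apply: lee_wpmul2r; first exact: poweR_ge0.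
rewrite lee_fin expRM ge0_ler_powR ?nnegrE ?expR_ge0//.
- by rewrite invr_ge0 addr_ge0// ltW.
- apply: divr_ge0; first by rewrite addr_ge0// mulr_ge0 ?powR_ge0 ?subr_ge0.
  by rewrite subr_ge0 ler_peMr ?ltW// expR_gt1.
- exact: chord_le_expR_h_eps.
Qed.

(** * Approximate privacy and the whole game *)

Lemma power_dominated_approxDP d (T : measurableType d) (R : realType)
    (P Q : probability T R) (l H eg : R) (S : set T) : 0 < l ->
  power_dominated (l / (1 + l)) (expR (H / (1 + l))) P Q -> measurable S ->
  (P S <= (expR eg)%:E * Q S + (expR (- (l * eg) + H))%:E)%E.
Proof.
move=> l0 PQ mS.
have l1 : 0 < 1 + l by rewrite addr_gt0.
have l1' : 1 + l != 0 by rewrite gt_eqF.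
set theta := l / (1 + l) in PQ *.
have theta0 : 0 < theta by rewrite divr_gt0.
have theta1 : theta <= 1 by rewrite ler_pdivrMr// mul1r lerDr.
have := PQ (\1_S : T -> R).
rewrite integral_indic// setIT.
have -> : (\int[P]_x (\1_S x `^ theta)%:E = \int[P]_x (\1_S x)%:E)%E.
  apply: eq_integral => x _; rewrite indicE; case: (x \in S).
    by rewrite powR1.
  by rewrite powR0// gt_eqF.
rewrite integral_indic// setIT => /(_ (measurable_indic _)).
have PS : P S \is a fin_num by exact: fin_num_measure.
have QS : Q S \is a fin_num by exact: fin_num_measure.
move=> /(_ mS) h; have {h} : (P S <= (expR (H / (1 + l)))%:E * Q S `^ theta)%E.
  by apply: h => x; rewrite indicE; case: (x \in S); rewrite !lexx ?ler01.
have QS0 : (0 <= Q S)%E by exact: measure_ge0.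
move: PS QS QS0.
case: (P S) => [u||]//; case: (Q S) => [v||]// _ _; rewrite lee_fin => v0.
rewrite -EFinM -EFinD !lee_fin => /le_trans; apply.
(* Young's inequality with exponents [1 / theta] and [1 + l]: the product of the two factors is
   [expR (H / (1 + l)) * v ^ theta], and their powers are the two target terms. *)
have := @conjugate_powR R ((expR eg * v) `^ theta)
  (expR ((H - l * eg) / (1 + l))) theta^-1 (1 + l) (powR_ge0 _ _) (expR_ge0 _).
rewrite invr_gt0 theta0 l1 => /(_ isT isT).
rewrite invrK (_ : theta + (1 + l)^-1 = 1); last by rewrite /theta; field.
move=> /(_ erefl).
rewrite -powRrM mulfV ?gt_eqF// powRr1 ?mulr_ge0 ?expR_ge0// -expRM divfK//.
rewrite powRM ?expR_ge0// -expRM.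
rewrite mulrAC -expRD (_ : eg * theta + _ = H / (1 + l)); last first.
  by rewrite /theta; field.
(* The Young weights [theta] and [1 / (1 + l)] are at most 1 and are dropped. *)
move=> /le_trans; apply; apply: lerD.
  by rewrite ler_piMr ?mulr_ge0 ?expR_ge0.
rewrite [- _ + _]addrC ler_pdivrMr// ler_peMr ?expR_ge0//.
by rewrite lerDl ltW.
Qed.

Lemma approxDP_inf d (T : measurableType d) (R : realType)
    (P Q : probability T R) (c : R) (D : set R) (S : set T) :
  measurable S -> D !=set0 ->
  (forall delta, D delta -> (P S <= c%:E * Q S + delta%:E)%E) ->
  (P S <= c%:E * Q S + (inf D)%:E)%E.
Proof.
move=> mS D0.
have : P S \is a fin_num by exact: fin_num_measure.
have : Q S \is a fin_num by exact: fin_num_measure.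
case: (P S) => [u||]//; case: (Q S) => [v||]// _ _ PQ.
rewrite -EFinM -EFinD lee_fin addrC -lerBlDr; apply: lb_le_inf => // delta Dd.
by rewrite lerBlDr addrC -lee_fin EFinD EFinM PQ.
Qed.

(** Each round extends the view twice: by the outcome, with the mechanism's constant, and by the
    adversary's coins, drawn from the same kernel in both games, with constant 1. *)
Lemma run_power_dominated (R : realType) (X : Type) (nb : X -> X -> Prop)
    (nb_sym : forall x x', nb x x' -> nb x' x) (k : nat)
    (dY dU : nat -> measure_display)
    (Y : forall i, measurableType (dY i)) (U : forall i, measurableType (dU i))
    (eps : 'I_k -> R) (eps_gt0 : forall i, 0 < eps i)
    (A : adversary nb U (fun i : 'I_k => bounded_range (Y := Y i) nb (eps i)))
    (b : bool) (l : R) : 0 < l -> forall n (le_nk : (n <= k)%N),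
  power_dominated (l / (1 + l))
    (\prod_(i < k | (i < n)%N) expR (h_eps (eps i) l / (1 + l)))
    (run A b le_nk) (run A (~~ b) le_nk).
Proof.
move=> l0.
have theta01 : 0 < l / (1 + l) < 1.
  by rewrite divr_gt0 ?addr_gt0//= ltr_pdivrMr ?addr_gt0// mul1r ltrDr.
elim=> [|n IHn] lt_nk.
  rewrite big_pred0//; apply: power_dominated_refl => //.
  exact: probability_setT.
rewrite (bigD1 (Ordinal lt_nk))//=.
rewrite (eq_bigl (fun i : 'I_k => (i < n)%N)); last first.
  by move=> i; rewrite -val_eqE/= ltnS [RHS]ltn_neqAle andbC.
rewrite -[X in power_dominated _ X]mul1r.
apply: power_dominated_pextend => //; last first.
  by move=> z; apply: power_dominated_refl => //; exact: prob_kernel.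
apply: power_dominated_pextend => //.
move=> h; apply: (bounded_range_power_dominated (nb := nb)) => //.
  exact: (mech_in A (i := Ordinal lt_nk) h).
(* For [b = true] the datasets come in reversed order, whence the symmetry of [nb]. *)
case: b {IHn} => /=; last exact: (data_nb A (i := Ordinal lt_nk) h).
by apply: nb_sym; exact: (data_nb A (i := Ordinal lt_nk) h).
Qed.

Theorem theorem5 (R : realType) (X : Type) (nb : X -> X -> Prop)
    (nb_sym : forall x x', nb x x' -> nb x' x)
    (k : nat) (k_ge1 : (1 <= k)%N)
    (dY : nat -> measure_display) (Y : forall i, measurableType (dY i))
    (eps : 'I_k -> R) (eps_gt0 : forall i, 0 < eps i)
    (eg : R) (eg_ge0 : 0 <= eg) :
  DP_adaptive_composition nb
    (fun i : 'I_k => bounded_range (Y := Y i) nb (eps i))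
    eg (delta_g eps eg).
Proof.
move=> dU U A b S mS.
apply: approxDP_inf => // [|_ [l /= l0 <-]].
  (* The value at [l = 1] shows that the infimum is over a nonempty set. *)
  by exists (expR (- (1 * eg) + \sum_(i < k) h_eps (eps i) 1)), 1 => /=.
apply: power_dominated_approxDP => //.
(* The exponential of the divided sum is the product of the round constants at [n = k]. *)
rewrite mulr_suml expR_sum.
rewrite (eq_bigl (fun i : 'I_k => (i < k)%N)) => [|i]; last by rewrite ltn_ord.
exact: run_power_dominated.
Qed.
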